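(* Let $W=\{(W_i,\omega_i)\}_{i\in I}$ be a fusion frame in $\mathcal{H}$ and let the fusion frame $V=\{(V_i,\upsilon_i)\}_{i\in I}$ be a dual of $W$. The following are equivalent: (1) $V$ is a fusion Riesz basis. (2) $\mathcal{G}_{V,W}$ is the identity operator on $\left(\sum_{i\in I}\bigoplus V_i\right)_{\ell^2}$. (3) $\mathcal{G}_{V,W}$ has a left inverse.
   Context: $\mathcal{H}$ is a separable Hilbert space, $I$ a countable index set, and $\pi_X$ the orthogonal projection onto a closed subspace $X$. For closed subspaces $W_i\subseteq\mathcal{H}$, $\left(\sum_{i\in I}\bigoplus W_i\right)_{\ell^2}$ is the Hilbert space of all $\{f_i\}_{i\in I}$ with $f_i\in W_i$, $\sum_i\|f_i\|^2<\infty$, with inner product $\sum_i\langle f_i,g_i\rangle$. A family $W=\{(W_i,\omega_i)\}_{i\in I}$ of closed subspaces with weights $\omega_i>0$ is a fusion frame for $\mathcal{H}$ if there are $0<A_W\le B_W<\infty$ with $A_W\|f\|^2\le\sum_i\omega_i^2\|\pi_{W_i}f\|^2\le B_W\|f\|^2$ for all $f\in\mathcal{H}$. Its synthesis operator is $T_W:\left(\sum_i\bigoplus W_i\right)_{\ell^2}\to\mathcal{H}$, $T_W\{f_i\}=\sum_i\omega_if_i$, with adjoint $T_W^*f=\{\omega_i\pi_{W_i}f\}_{i\in I}$; $S_W=T_WT_W^*$ is the (bounded, positive, invertible) fusion frame operator. A family $V=\{(V_i,\upsilon_i)\}_{i\in I}$ of closed subspaces with weights $\upsilon_i>0$ is a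 fusion Riesz basis for $\mathcal{H}$ if the closed linear span of the $V_i$ is $\mathcal{H}$ and there are $0<C\le D<\infty$ such that for every finite $J\subseteq I$ and all $f_j\in V_j$ ($j\in J$), $C\sum_{j\in J}\|f_j\|^2\le\left\|\sum_{j\in J}\upsilon_jf_j\right\|^2\le D\sum_{j\in J}\|f_j\|^2$. For fusion frames $V,W$, the bounded operator $\phi_{VW}:\left(\sum_i\bigoplus W_i\right)_{\ell^2}\to\left(\sum_i\bigoplus V_i\right)_{\ell^2}$ is $\phi_{VW}\{f_i\}=\{\pi_{V_i}S_W^{-1}f_i\}$. $V$ is a (Găvruţa-)dual of $W$ if $T_V\phi_{VW}T_W^*=I_{\mathcal{H}}$, i.e. $f=\sum_i\omega_i\upsilon_i\pi_{V_i}S_W^{-1}\pi_{W_i}f$ for all $f\in\mathcal{H}$. The fusion cross Gram matrix is the operator $\mathcal{G}_{V,W}=\phi_{VW}T_W^*T_V$ on $\left(\sum_i\bigoplus V_i\right)_{\ell^2}$. *)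

(* Defs.v *)
From HB Require Import structures.
From mathcomp Require Import all_boot all_order all_algebra finmap.
From mathcomp Require Import complex.
From mathcomp Require Import all_classical all_reals all_analysis.
From mathcomp Require Import showcase.summability.
Import Order.TTheory GRing.Theory Num.Theory.
Import numFieldNormedType.Exports.

Set Implicit Arguments.
Unset Strict Implicit.
Unset Printing Implicit Defensive.

Local Open Scope classical_set_scope.
Local Open Scope ring_scope.

(* Hilbert spaces are taken over the reals or over the complex numbers.  In the
   complex case, the norm of a normedModType has values in R[i], and [0 < a],
   [a <= b] there imply that a, resp. b - a, is a real number. *)
Variant scalar_kind := RealScalars | ComplexScalars.

Definition scalar_field (R : realType) (k : scalar_kind) : numFieldType :=
  match k with
  | RealScalars => R
  | ComplexScalars => R[i]
  end.

Definition conj_scalar (R : realType) (k : scalar_kind) :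
    {rmorphism scalar_field R k -> scalar_field R k} :=
  match k return {rmorphism scalar_field R k -> scalar_field R k} with
  | RealScalars => idfun
  | ComplexScalars => @conjc R
  end.

Section FusionFrames.
Variables (R : realType) (k : scalar_kind).
Let K := scalar_field R k.
Variable H : completeNormedModType K.

Definition separable_space := exists2 D : set H, countable D & dense D.

Definition linear_subspace (X : set H) : Prop := submod_closed (mem X).

Definition closed_subspace (X : set H) := linear_subspace X /\ closed X.

Definition closed_span (X : set H) : set H := closure (smallest linear_subspace X).

Variable dot : {dot H for conj_scalar R k}.

(* Makes the complete normed module H a Hilbert space for [dot]. *)
Definition norm_induced_by_dot := forall x : H, `|x| ^+ 2 = dot x x.

Definition orth_proj (X : set H) (f : H) : H :=
  xget 0 [set p | X p /\ forall x, X x -> dot (f - p) x = 0].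

Variable I : countType.
Implicit Types (V W : I -> set H) (u w : I -> K) (f : I -> H).

(* Convergence of the net of sums over finite sets of indices, i.e.
   unconditional convergence; [sum] is the limit of this net. *)
Definition unconditionally_cvg (E : normedModType K) (x : I -> E) :=
  cvg (partial_sum x @ totally).

Definition l2_norm2 f : K := sum (fun i => `|f i| ^+ 2 : K).

(* Operators on (\sum_i (+) W_i)_l2 are functions on families I -> H, of which
   only the values on [l2_sum W] are meaningful. *)
Definition l2_sum W : set (I -> H) :=
  [set f | (forall i, W i (f i)) /\
           unconditionally_cvg (fun i => `|f i| ^+ 2 : K)].

Definition weighted_family W w :=
  (forall i, closed_subspace (W i)) /\ (forall i, 0 < w i).

Definition fusion_frame W w :=
  weighted_family W w /\
  exists A B : K, [/\ 0 < A, A <= B &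
    forall h : H,
      unconditionally_cvg (fun i => w i ^+ 2 * `|orth_proj (W i) h| ^+ 2 : K) /\
      A * `|h| ^+ 2 <= sum (fun i => w i ^+ 2 * `|orth_proj (W i) h| ^+ 2 : K)
                    <= B * `|h| ^+ 2].

Definition synthesis w f : H := sum (fun i => w i *: f i).

(* The adjoint of the synthesis operator of (W, w). *)
Definition analysis W w (h : H) : I -> H := fun i => w i *: orth_proj (W i) h.

Definition frame_op W w (h : H) : H := synthesis w (analysis W w h).

(* The inverse of [frame_op W w], which is bijective when (W, w) is a fusion
   frame. *)
Definition frame_op_inv W w (h : H) : H :=
  xget 0 [set g | frame_op W w g = h].

Definition phi V W w f : I -> H :=
  fun i => orth_proj (V i) (frame_op_inv W w (f i)).

Definition dual_of V u W w :=
  forall h : H, synthesis u (phi V W w (analysis W w h)) = h.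

Definition cross_gram V u W w f : I -> H :=
  phi V W w (analysis W w (synthesis u f)).

Definition fusion_riesz_basis V u :=
  [/\ weighted_family V u,
      closed_span (\bigcup_i V i) = setT &
      exists C D : K, [/\ 0 < C, C <= D &
        forall (J : {fset I}) (f : I -> H),
          (forall j, j \in J -> V j (f j)) ->
          C * (\sum_(j <- J) `|f j| ^+ 2)
            <= `|\sum_(j <- J) u j *: f j| ^+ 2
            <= D * (\sum_(j <- J) `|f j| ^+ 2)]].

Definition bounded_operator V (L : (I -> H) -> (I -> H)) :=
  [/\ forall f, l2_sum V f -> l2_sum V (L f),
      forall (a : K) f g, l2_sum V f -> l2_sum V g ->
        L (a *: f + g) = a *: L f + L g &
      exists2 M : K, 0 <= M &
        forall f, l2_sum V f -> l2_norm2 (L f) <= M ^+ 2 * l2_norm2 f].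

Definition is_identity_on V (T : (I -> H) -> (I -> H)) :=
  forall f, l2_sum V f -> T f = f.

Definition has_left_inverse V (T : (I -> H) -> (I -> H)) :=
  exists2 L, bounded_operator V L & is_identity_on V (L \o T).

End FusionFrames.

(* Main.v *)
Require Import Defs.
From mathcomp Require Import all_boot all_order all_algebra finmap.
From mathcomp Require Import complex ring.
From mathcomp Require Import all_classical all_reals all_analysis.
From mathcomp Require Import showcase.summability.
Import Order.TTheory GRing.Theory Num.Theory.
Import numFieldNormedType.Exports.

Set Implicit Arguments.
Unset Strict Implicit.
Unset Printing Implicit Defensive.

Local Open Scope classical_set_scope.
Local Open Scope ring_scope.

(** Since T_V phi_VW T_W^* = 1, the Gram operator G = phi_VW T_W^* T_V satisfies
    T_V G = T_V and G^2 = G.  Hence G = 1 as soon as G has a left inverse, or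
    T_V is injective on the l2 sum, as it is for a Riesz basis.  Conversely, if
    G = 1 then |f| = |phi_VW T_W^* T_V f| <= M |T_V f| is the lower Riesz bound;
    the upper one is the Bessel bound of V, and the V_i span a dense subspace
    because every h is the limit of the finite partial sums of
    T_V (phi_VW T_W^* h). *)

#[local] Existing Instance totally_filter.

(** * Order, infima and limits in the scalar field *)

Lemma mul_conj_scalar (R : realType) (k : scalar_kind) (a : scalar_field R k) :
  a * conj_scalar R k a = `|a| ^+ 2.
Proof.
case: k a => [a|a] /=; first by rewrite real_normK ?num_real// expr2.
by rewrite sqr_normc.
Qed.

(** In the complex case [0 <= x] forces [x] to be real, so the infimum is that of the real parts,
    embedded back into [R[i]]. It yields both the limits of monotone sums and the minimal distances
    to a subspace. *)
Lemma ge0_has_inf_scalar (R : realType) (k : scalar_kind)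
    (E : set (scalar_field R k)) :
  E !=set0 -> (forall x, E x -> 0 <= x) ->
  exists d, [/\ 0 <= d, forall x, E x -> d <= x &
    forall e, 0 < e -> exists2 x, E x & x < d + e].
Proof.
case: k E => [E|E] /= E0 Ege0.
  have hE : has_inf E by split => //; exists 0.
  exists (inf E); split; first exact: lb_le_inf.
  - by move=> x Ex; apply: ge_inf => //; case: hE.
  - move=> e e0; have [x Ex xe] := @inf_adherent _ E _ e0 hE.
    by exists x.
pose F : set R := [set complex.Re x | x in E].
have ReK x : E x -> x = (complex.Re x)%:C%C.
  by case: x => a b /Ege0; rewrite lecE /= => /andP[/eqP -> _].
have F0 : F !=set0 by case: E0 => x Ex; exists (complex.Re x), x.
have Fge0 x : F x -> 0 <= x.
  by case=> y /Ege0; rewrite lecE /= => /andP[_ y0] <-.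
have hF : has_inf F by split => //; exists 0.
exists (inf F)%:C%C; split.
- by rewrite lecR; exact: lb_le_inf.
- move=> x Ex; rewrite (ReK _ Ex) lecR; apply: ge_inf; first by case: hF.
  by exists x.
- move=> [e e'] e0; have {}e0 : e' = 0 /\ 0 < e.
    by move: e0; rewrite ltcE /= => /andP[/eqP].
  case: e0 => -> e0; have [_ [x Ex <-] xe] := @inf_adherent _ F _ e0 hF.
  exists x => //; rewrite (ReK _ Ex) -[Complex e 0]/(e%:C)%C -rmorphD.
  by rewrite ltcR.
Qed.

(** A nonnegative term equals its norm; by continuity the limit equals its own norm. The order of
    [K] need not be total for this. *)
Lemma cvg_scalar_ge0 (K : numFieldType) (T : Type) (F : set_system T)
    {FF : ProperFilter F} (x : T -> K) a :
  x t @[t --> F] --> a -> (\forall t \near F, 0 <= x t) -> 0 <= a.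
Proof.
move=> xa x0; suff <- : `|a| = a by [].
apply: (cvg_unique (@norm_hausdorff _ _) _ xa).
apply: cvg_trans (cvg_norm xa); apply: near_eq_cvg.
by near=> t; rewrite ger0_norm//; near: t.
Unshelve. all: by end_near. Qed.

Lemma le_cvg_scalar (K : numFieldType) (T : Type) (F : set_system T)
    {FF : ProperFilter F} (x y : T -> K) a b :
    x t @[t --> F] --> a -> y t @[t --> F] --> b ->
  (\forall t \near F, x t <= y t) -> a <= b.
Proof.
move=> xa yb xy; rewrite -subr_ge0.
apply: (cvg_scalar_ge0 (cvgB yb xa)).
by near=> t; rewrite subr_ge0; near: t.
Unshelve. all: by end_near. Qed.

(** The difference of the two sides is [(B * a - b) ^+ 2 / B], and the square is nonnegative because
    [B * a - b] is real. *)
Lemma young_ineq2 (K : numFieldType) (B a b : K) :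
  0 < B -> 0 <= a -> 0 <= b -> 2 * (a * b) <= B * a ^+ 2 + b ^+ 2 / B.
Proof.
move=> B0 a0 b0; rewrite -subr_ge0.
rewrite (_ : _ - _ = (B * a - b) ^+ 2 / B); last by field; rewrite gt_eqF.
rewrite divr_ge0 ?(ltW B0)// real_exprn_even_ge0// rpredB// ger0_real//.
by rewrite mulr_ge0 ?(ltW B0).
Qed.

(** * Unconditional sums as limits over finite index sets *)

Lemma partial_sumE (I : choiceType) (M : zmodType) (x : I -> M) (J : {fset I}) :
  partial_sum x J = \sum_(i <- J) x i.
Proof. by rewrite /partial_sum big_seq_fsetE. Qed.

Lemma near_totally (I : choiceType) (P : {fset I} -> Prop) (A : {fset I}) :
  (forall B : {fset I}, (A `<=` B)%fset -> P B) -> \forall J \near totally, P J.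
Proof. by move=> AP; exists A. Qed.

Lemma partial_sumB (I : choiceType) (M : zmodType) (x : I -> M)
    (A B : {fset I}) : (A `<=` B)%fset ->
  partial_sum x B - partial_sum x A = partial_sum x (B `\` A)%fset.
Proof.
move=> AB; rewrite !partial_sumE (big_fsetID _ (mem A) B) /=.
rewrite (_ : [fset _ in B | _ \in A]%fset = A); last first.
  apply/fsetP => i; rewrite !inE /= andb_idl//; exact: (fsubsetP AB).
rewrite (_ : [fset _ in B | _ \notin A]%fset = (B `\` A)%fset); last first.
  by apply/fsetP => i; rewrite !inE /= andbC.
by rewrite addrAC subrr add0r.
Qed.

Lemma sum_unique (I : choiceType) (K : numFieldType) (E : normedModType K)
    (x : I -> E) s : partial_sum x @ totally --> s -> sum x = s.
Proof. by move=> xs; apply: cvg_lim xs; exact: norm_hausdorff. Qed.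

Lemma finite_support_cvg (I : choiceType) (K : numFieldType)
    (E : normedModType K) (x : I -> E) (J : {fset I}) :
  (forall i, i \notin J -> x i = 0) ->
  partial_sum x @ totally --> partial_sum x J.
Proof.
move=> x0; apply: cvg_near_cst; apply: (@near_totally _ _ J) => B JB.
apply/eqP; rewrite -subr_eq0 partial_sumB// partial_sumE big_seq.
by rewrite big1// => i; rewrite inE => /andP[/x0].
Qed.

Lemma le_partial_sum (I : choiceType) (K : numDomainType) (a : I -> K)
    (A B : {fset I}) : (forall i, 0 <= a i) ->
  (A `<=` B)%fset -> partial_sum a A <= partial_sum a B.
Proof.
by move=> a0 AB; rewrite -subr_ge0 partial_sumB// sumr_ge0.
Qed.

Lemma partial_sum_le_sum (R : realType) (k : scalar_kind) (I : countType)
    (a : I -> scalar_field R k) (J : {fset I}) :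
  (forall i, 0 <= a i) -> unconditionally_cvg a ->
  partial_sum a J <= sum a.
Proof.
move=> a0 ac; apply: (le_cvg_scalar (cvg_cst (partial_sum a J)) ac).
by apply: (@near_totally _ _ J) => B; exact: le_partial_sum.
Qed.

(** The gaps [M - partial_sum a J] are nonnegative and decrease as [J] grows, so they tend to their
    infimum [d], and the sum is [M - d]. *)
Lemma bounded_unconditionally_cvg (R : realType) (k : scalar_kind)
    (I : countType) (a : I -> scalar_field R k) (M : scalar_field R k) :
  (forall i, 0 <= a i) -> (forall J, partial_sum a J <= M) ->
  unconditionally_cvg a.
Proof.
move=> a0 aM.
have [] := @ge0_has_inf_scalar R k (range (fun J => M - partial_sum a J)).
- by exists (M - partial_sum a fset0), fset0.
- by move=> _ [J _ <-]; rewrite subr_ge0.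
move=> d [_ dmin dinf]; apply/cvg_ex; exists (M - d).
apply/cvgrPdist_lt => e e0.
have [_ [A _ <-] Ae] := dinf e e0.
apply: (@near_totally _ _ A) => B AB.
have /dmin dB : range (fun J => M - partial_sum a J) (M - partial_sum a B).
  by exists B.
rewrite addrAC ger0_norm ?subr_ge0// ltrBlDl; apply: le_lt_trans Ae.
by rewrite lerD2l lerN2 le_partial_sum.
Qed.

(** Cauchy criterion: beyond [A], two partial sums of [x] differ by a sum over indices outside [A],
    whose squared norm is at most [B] times the tail of [a]. *)
Lemma dominated_unconditionally_cvg (R : realType) (k : scalar_kind)
    (E : completeNormedModType (scalar_field R k)) (I : countType) (x : I -> E)
    (a : I -> scalar_field R k) (B : scalar_field R k) :
  0 < B -> (forall i, 0 <= a i) -> unconditionally_cvg a ->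
  (forall J, `|partial_sum x J| ^+ 2 <= B * partial_sum a J) ->
  unconditionally_cvg x.
Proof.
move=> B0 a0 ac xa; apply: cauchy_cvg; apply/cauchyP => e e0.
have eB0 : 0 < e ^+ 2 / B by rewrite divr_gt0 ?exprn_gt0.
have /cvgrPdist_lt /(_ _ eB0) [A _ HA] := ac.
exists (partial_sum x A); apply: (@near_totally _ _ A) => C AC /=.
rewrite -ball_normE /= distrC partial_sumB//.
rewrite -(@ltr_pXn2r _ 2) ?nnegrE ?normr_ge0 ?(ltW e0)//.
apply: le_lt_trans (xa _) _; rewrite mulrC -ltr_pdivlMr// -partial_sumB//.
apply: le_lt_trans (HA A (fsubset_refl A)).
rewrite ger0_norm ?lerD2r ?subr_ge0; exact: partial_sum_le_sum.
Qed.

(** * Inner product geometry and orthogonal projections *)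

Section HilbertSpace.
Variables (R : realType) (k : scalar_kind).
Local Notation K := (scalar_field R k).
Variables (H : completeNormedModType K) (dot : {dot H for conj_scalar R k}).
Hypothesis Hdot : norm_induced_by_dot dot.
Local Notation conjK := (conj_scalar R k).

Lemma dotC x y : dot x y = conjK (dot y x).
Proof. by rewrite hermC expr0 mul1r. Qed.

Lemma dotDl x y z : dot (x + y) z = dot x z + dot y z.
Proof. exact: linearDl. Qed.

Lemma dotBl x y z : dot (x - y) z = dot x z - dot y z.
Proof. exact: linearBl. Qed.

Lemma dotZl a x z : dot (a *: x) z = a * dot x z.
Proof. exact: linearZl_LR. Qed.

Lemma dot0l z : dot 0 z = 0.
Proof. exact: linear0l. Qed.

Lemma dotDr x y z : dot z (x + y) = dot z x + dot z y.
Proof. exact: linearDr. Qed.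

Lemma dotBr x y z : dot z (x - y) = dot z x - dot z y.
Proof. exact: linearBr. Qed.

Lemma dotZr a x z : dot z (a *: x) = conjK a * dot z x.
Proof. by rewrite dotC dotZl rmorphM /= -dotC. Qed.

Lemma dot0r z : dot z 0 = 0.
Proof. by rewrite dotC dot0l rmorph0. Qed.

Lemma dot_suml (T : Type) (r : seq T) (P : pred T) (F : T -> H) z :
  dot (\sum_(i <- r | P i) F i) z = \sum_(i <- r | P i) dot (F i) z.
Proof.
by elim/big_rec2: _ => [|i a b _ <-]; [exact: dot0l|exact: dotDl].
Qed.

Lemma parallelogram (x y : H) :
  `|x + y| ^+ 2 + `|x - y| ^+ 2 = 2 * (`|x| ^+ 2 + `|y| ^+ 2).
Proof. by rewrite !Hdot !(dotBl, dotBr, dotDl, dotDr); ring. Qed.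

Lemma pythagoras x y : dot x y = 0 -> `|x + y| ^+ 2 = `|x| ^+ 2 + `|y| ^+ 2.
Proof.
by move=> xy; rewrite !Hdot dotDl !dotDr xy [dot y x]dotC xy rmorph0; ring.
Qed.

(** The subtracted vector is the projection of [x] onto the line of [y], so Pythagoras applies. *)
Lemma norm_sub_dot_scale x y : `|y| ^+ 2 != 0 ->
  `|x - (dot x y / `|y| ^+ 2) *: y| ^+ 2 =
    `|x| ^+ 2 - `|dot x y| ^+ 2 / `|y| ^+ 2.
Proof.
move=> y0; set t := dot x y / _.
have tyE : dot (x - t *: y) (t *: y) = 0.
  by rewrite dotZr dotBl dotZl -Hdot /t divfK// subrr mulr0.
have -> : `|x| ^+ 2 = `|x - t *: y| ^+ 2 + `|t *: y| ^+ 2.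
  by rewrite -pythagoras// subrK.
rewrite normrZ exprMn /t normf_div normrX normr_id.
set a := `|_ - _|; set b := `|_|; set c := `|y|.
have c0 : c ^+ 2 != 0 by [].
rewrite -(addrA (a ^+ 2)) (_ : _ - _ = 0) ?addr0//.
apply/eqP; rewrite subr_eq0 expr_div_n; apply/eqP.
by rewrite [c ^+ 2 ^+ 2]expr2 invfM -!mulrA mulVf// mulr1.
Qed.

(** Cauchy-Schwarz: the left side of [norm_sub_dot_scale] is nonnegative. *)
Lemma norm_dot_le x y : `|dot x y| <= `|x| * `|y|.
Proof.
have [->|y0] := eqVneq y 0; first by rewrite dot0r normr0 mulr_ge0.
have y20 : `|y| ^+ 2 != 0 by rewrite expf_eq0 /= normr_eq0.
have : 0 <= `|x - (dot x y / `|y| ^+ 2) *: y| ^+ 2 by rewrite exprn_ge0.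
rewrite norm_sub_dot_scale// subr_ge0 ler_pdivrMr ?exprn_gt0 ?normr_gt0//.
by rewrite -exprMn ler_pXn2r ?nnegrE ?mulr_ge0.
Qed.

Lemma cvg_dotl (T : Type) (F : set_system T) {FF : Filter F} (x : T -> H) a z :
  x t @[t --> F] --> a -> dot (x t) z @[t --> F] --> dot a z.
Proof.
move=> /cvgrPdist_lt xa; apply/cvgrPdist_lt => e e0.
have z1 : 0 < `|z| + 1 by rewrite ltr_wpDl.
near=> t; rewrite -dotBl; apply: le_lt_trans (norm_dot_le _ _) _.
apply: (@le_lt_trans _ _ (`|a - x t| * (`|z| + 1))).
  by rewrite ler_wpM2l// lerDl.
by rewrite -ltr_pdivlMr//; near: t; apply: xa; rewrite divr_gt0.
Unshelve. all: by end_near. Qed.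

(** Near-minimizers of the distance from [f] to [X] form a Cauchy filter by the parallelogram law.
    Its limit attains the infimum, and minimality forces orthogonality. *)
Lemma exists_orthogonal_proj (X : set H) (f : H) : closed_subspace X ->
  exists2 p, X p & forall x, X x -> dot (f - p) x = 0.
Proof.
move=> [[/set_mem X0 XB] Xclosed].
have XD (a : K) x y : X x -> X y -> X (a *: x + y).
  by move=> /mem_set Xx /mem_set Xy; apply/set_mem; exact: XB.
have [] := @ge0_has_inf_scalar R k [set `|f - x| ^+ 2 | x in X].
- by exists (`|f - 0| ^+ 2), 0.
- by move=> _ [x _ <-]; rewrite exprn_ge0.
move=> d [_ dmin dinf].
pose A (e : K) := [set x | X x /\ `|f - x| ^+ 2 <= d + e].
(* The sets [A e] are nested and nonempty, hence a filter base; no minimizing sequence has to be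
   chosen. *)
pose F := filter_from [set e : K | 0 < e] A.
have FF : ProperFilter F.
  apply: filter_from_proper => [|e /= /dinf[_ [x Xx <-] xe]]; last first.
    by exists x; split => //; exact: ltW.
  apply: filter_from_filter; first by exists 1; exact: ltr01.
  move=> e e' /= e0 e'0; exists (Num.min e e').
    by rewrite /Order.min; case: ifP.
  move=> x [Xx]; rewrite /Order.min /=; case: ifP => [ee'|] hx.
    by split; split => //; rewrite (le_trans hx)// lerD2l ltW.
  (* Positive scalars are real, hence comparable, so the failure of [e < e'] gives [e' <= e]. *)
  have e_real : e \is Num.real by exact: gtr0_real.
  have e'_real : e' \is Num.real by exact: gtr0_real.
  move: hx; rewrite real_ltNge// => /negbFE e'e xe'.
  by split; split => //; rewrite (le_trans xe')// lerD2l.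
(* The midpoint of [x] and [y] lies in [X], so its squared distance to [f] is at least [d]; the
   parallelogram law then leaves at most [4 * e] for the squared distance of [x] and [y]. *)
have Adist e x y : A e x -> A e y -> `|x - y| ^+ 2 <= 4 * e.
  move=> [Xx xe] [Xy ye].
  have Xm : X (2^-1 *: (x + y)).
    rewrite scalerDr; apply: (XD) => //.
    by rewrite -[_ *: y]addr0; exact: XD.
  have /dmin dm : [set `|f - x| ^+ 2 | x in X] (`|f - 2^-1 *: (x + y)| ^+ 2).
    by exists (2^-1 *: (x + y)).
  have := parallelogram (f - x) (f - y).
  have -> : f - x - (f - y) = - (x - y).
    by rewrite opprB addrC addrA subrK opprB.
  have -> : f - x + (f - y) = 2 *: (f - 2^-1 *: (x + y)).
    rewrite scalerBr scalerA divff ?pnatr_eq0// scale1r scaler_nat mulr2n.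
    by rewrite opprD !addrA (addrAC f).
  rewrite normrN normrZ exprMn (_ : `|2 : K| ^+ 2 = 4); last first.
    by rewrite ger0_norm// expr2 -natrM.
  move=> E; rewrite -(lerD2l (4 * `|f - 2^-1 *: (x + y)| ^+ 2)) E.
  apply: (@le_trans _ _ (2 * (d + e + (d + e)))).
    by rewrite ler_pM2l// lerD.
  rewrite (_ : 2 * _ = 4 * d + 4 * e); last by ring.
  by rewrite lerD2r ler_pM2l.
have Fc : cauchy F.
  apply/cauchyP => e e0.
  (* With this tolerance [Adist] gives half of [e ^+ 2], so the bound is strict. *)
  have e2 : 0 < e ^+ 2 / 8 by rewrite divr_gt0 ?exprn_gt0.
  have /dinf [_ [x Xx <-] xe] := e2.
  exists x, (e ^+ 2 / 8) => // y Ay; rewrite -ball_normE /=.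
  have : `|x - y| ^+ 2 < e ^+ 2.
    apply: le_lt_trans (Adist _ _ _ _ Ay) _; first by split => //; exact: ltW.
    rewrite (_ : 4 * _ = e ^+ 2 / 2); last by field.
    by rewrite ltr_pdivrMr// mulr_natr mulr2n ltrDl exprn_gt0.
  by rewrite ltr_pXn2r ?nnegrE// ltW.
pose p := lim F; have Fp : F --> p by exact: cauchy_cvg Fc.
have XF : F X by exists 1 => [|x []]; first exact: ltr01.
have Xp : X p by exact: (@closed_cvg _ _ F _ id X Xclosed XF p Fp).
have pmin : `|f - p| ^+ 2 <= d.
  apply/ler_addgt0Pr => e e0.
  have Fn : `|f - x| ^+ 2 @[x --> F] --> `|f - p| ^+ 2.
    rewrite expr2 (_ : (fun x => _) = (fun x => `|f - x| * `|f - x|)).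
      have c : `|f - x| @[x --> F] --> `|f - p|.
        by apply: cvg_norm; apply: cvgB => //; exact: cvg_cst.
      exact: cvgM.
    by apply/funext => x; rewrite expr2.
  apply: (le_cvg_scalar Fn (cvg_cst (d + e))).
  by exists e => // x [].
exists p => // x Xx.
have [->|x0] := eqVneq x 0; first exact: dot0r.
have x20 : `|x| ^+ 2 != 0 by rewrite expf_eq0 /= normr_eq0.
(* This [t] brings [p + t *: x] closest to [f]. Since [p] is already minimal, the gain
   [|dot (f - p) x| ^+ 2 / |x| ^+ 2] must vanish. *)
set t := dot (f - p) x / `|x| ^+ 2.
have /dmin : [set `|f - x| ^+ 2 | x in X] (`|f - p - t *: x| ^+ 2).
  exists (t *: x + p); first exact: XD.
  by rewrite opprD addrA addrAC.
rewrite norm_sub_dot_scale// lerBrDl => /le_trans /(_ pmin).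
rewrite gerDr pmulr_lle0 ?invr_gt0 ?exprn_gt0 ?normr_gt0//.
by rewrite real_exprn_even_le0 ?normr_real//= normr_eq0 => /eqP.
Qed.

Lemma orth_projP (X : set H) (f : H) : closed_subspace X ->
  X (orth_proj dot X f) /\ forall x, X x -> dot (f - orth_proj dot X f) x = 0.
Proof.
move=> cX; have [p Xp p_orth] := exists_orthogonal_proj f cX.
by apply: (@xgetPex H 0 [set p | X p /\ _]); exists p.
Qed.

Lemma dot_orth_proj (X : set H) (x f : H) : closed_subspace X -> X x ->
  dot x (orth_proj dot X f) = dot x f.
Proof.
move=> /(orth_projP f)[_ p_orth] Xx; apply/esym/eqP.
by rewrite -subr_eq0 -dotBr dotC p_orth// rmorph0.
Qed.

Lemma norm_orth_proj_sqr (X : set H) (f : H) : closed_subspace X ->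
  `|orth_proj dot X f| ^+ 2 = dot (orth_proj dot X f) f.
Proof.
move=> cX; rewrite -(dot_orth_proj f cX) ?Hdot//.
exact: (orth_projP f cX).1.
Qed.

Lemma norm_orth_proj_le (X : set H) (f : H) : closed_subspace X ->
  `|orth_proj dot X f| <= `|f|.
Proof.
move=> cX; have [->|p0] := eqVneq (orth_proj dot X f) 0.
  by rewrite normr0.
have := norm_dot_le (orth_proj dot X f) f.
rewrite -norm_orth_proj_sqr// ger0_norm ?exprn_ge0// expr2.
by rewrite ler_pM2l ?normr_gt0.
Qed.

(** * Bessel bounds, synthesis and the frame operator *)

Section Families.
Variable I : countType.
Implicit Types (V W : I -> set H) (u w : I -> K) (f : I -> H).

(** The upper frame inequality alone, on finite sums so that no convergence is presupposed. *)
Definition bessel_bound W w (B : K) := forall (h : H) (J : {fset I}),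
  partial_sum (fun i => w i ^+ 2 * `|orth_proj dot (W i) h| ^+ 2) J <=
    B * `|h| ^+ 2.

(** The bound on analysis passes to its adjoint: [|y| ^+ 2] pairs each [f i] with [y], which may be
    replaced there by its projection onto [W i]. *)
Lemma bessel_synthesis_bound W w (B : K) (J : {fset I}) f :
  weighted_family W w -> 0 < B -> bessel_bound W w B ->
  (forall i, i \in J -> W i (f i)) ->
  `|partial_sum (fun i => w i *: f i) J| ^+ 2 <=
    B * partial_sum (fun i => `|f i| ^+ 2) J.
Proof.
move=> [cW w0] B0 hB Wf; set y := partial_sum _ J.
have yE : `|y| ^+ 2 <= \sum_(i <- J) `|f i| * (w i * `|orth_proj dot (W i) y|).
  rewrite -(ger0_norm (exprn_ge0 2 (normr_ge0 y))) {1}Hdot {1}/y.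
  rewrite partial_sumE dot_suml.
  apply: le_trans (ler_norm_sum _ _ _) _.
  rewrite big_seq [leRHS]big_seq; apply: ler_sum => i iJ.
  rewrite dotZl -(dot_orth_proj y (cW i) (Wf i iJ)) normrM (gtr0_norm (w0 i)).
  by rewrite mulrCA ler_wpM2l ?(ltW (w0 i))// norm_dot_le.
(* The inequality [2 a b <= B a^2 + b^2 / B] bounds each term of [yE]; the
   frame bound turns the second half into [|y|^2], which is then absorbed. *)
have : 2 * `|y| ^+ 2 <= B * partial_sum (fun i => `|f i| ^+ 2) J + `|y| ^+ 2.
  apply: le_trans (_ : \sum_(i <- J) (B * `|f i| ^+ 2 +
    w i ^+ 2 * `|orth_proj dot (W i) y| ^+ 2 / B) <= _).
    apply: (@le_trans _ _ (2 * \sum_(i <- J)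
        `|f i| * (w i * `|orth_proj dot (W i) y|))).
      by rewrite ler_pM2l.
    rewrite mulr_sumr; apply: ler_sum => i _.
    by rewrite -exprMn young_ineq2// mulr_ge0 ?(ltW (w0 i)).
  rewrite big_split -mulr_sumr -mulr_suml /= !partial_sumE lerD2l.
  rewrite ler_pdivrMr// mulrC -partial_sumE.
  exact: hB.
by rewrite mulr_natl mulr2n lerD2r.
Qed.

Lemma fusion_frame_bessel W w : fusion_frame dot W w ->
  exists2 B : K, 0 < B & bessel_bound W w B.
Proof.
move=> [[_ w0] [A [B [A0 AB hAB]]]]; exists B; first exact: lt_le_trans AB.
move=> h J; have [cv /andP[_]] := hAB h.
apply: le_trans; apply: partial_sum_le_sum cv => i.
by rewrite mulr_ge0 ?exprn_ge0 ?(ltW (w0 i)).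
Qed.

Lemma synthesis_cvg W w f : fusion_frame dot W w -> l2_sum W f ->
  unconditionally_cvg (fun i => w i *: f i).
Proof.
move=> FW [Wf cf]; have [B B0 hB] := fusion_frame_bessel FW.
apply: (dominated_unconditionally_cvg B0 _ cf) => [i|J].
  by rewrite exprn_ge0.
by apply: bessel_synthesis_bound B0 hB _ => //; case: FW.
Qed.

Lemma norm_analysis_sqr W w h i : weighted_family W w ->
  `|analysis dot W w h i| ^+ 2 = w i ^+ 2 * `|orth_proj dot (W i) h| ^+ 2.
Proof. by move=> [_ w0]; rewrite normrZ exprMn (gtr0_norm (w0 i)). Qed.

Lemma closed_subspaceZ (X : set H) a x : closed_subspace X -> X x -> X (a *: x).
Proof.
move=> [[X0 XB] _] /mem_set Xx; apply/set_mem.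
by rewrite -[a *: x]addr0; exact: XB.
Qed.

Lemma closed_subspaceB (X : set H) x y :
  closed_subspace X -> X x -> X y -> X (x - y).
Proof.
move=> [[_ XB] _] /mem_set Xx /mem_set Xy; apply/set_mem.
by rewrite addrC -scaleN1r; exact: XB.
Qed.

Lemma analysis_l2 W w h : fusion_frame dot W w -> l2_sum W (analysis dot W w h).
Proof.
move=> [FW [A [B [_ _ hAB]]]]; split=> [i|].
  have [cW _] := FW; apply: closed_subspaceZ (cW i) _.
  exact: (orth_projP h (cW i)).1.
have [cv _] := hAB h; rewrite /unconditionally_cvg.
rewrite (_ : (fun i => _) =
  (fun i => w i ^+ 2 * `|orth_proj dot (W i) h| ^+ 2 : K))//.
by apply/funext => i; exact: norm_analysis_sqr.
Qed.

(** The inner product of [frame_op dot W w g] with [g] is the frame sum of [g], hence at least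
    [A * |g| ^+ 2]; Cauchy-Schwarz allows one factor [|g|] to be cancelled. *)
Lemma frame_op_lower_bound W w : fusion_frame dot W w ->
  exists2 A : K, 0 < A & forall g, A * `|g| <= `|frame_op dot W w g|.
Proof.
move=> FW; have [[cW w0] [A [B [A0 AB hAB]]]] := FW.
exists A => // g; have [->|g0] := eqVneq g 0; first by rewrite normr0 mulr0.
have Sg : partial_sum (fun i => w i *: analysis dot W w g i) J @[J --> totally]
    --> frame_op dot W w g.
  exact: synthesis_cvg FW (analysis_l2 g FW).
have Sgg : dot (frame_op dot W w g) g =
    sum (fun i => w i ^+ 2 * `|orth_proj dot (W i) g| ^+ 2 : K).
  apply/esym/sum_unique; apply: cvg_trans (cvg_dotl (z := g) Sg).
  apply: near_eq_cvg; apply: nearW => J.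
  rewrite !partial_sumE dot_suml; apply: eq_bigr => i _.
  by rewrite !dotZl norm_orth_proj_sqr// mulrA expr2.
have [_ /andP[+ _]] := hAB g; rewrite -Sgg => lb.
have Sg0 : 0 <= dot (frame_op dot W w g) g.
  by apply: le_trans lb; rewrite mulr_ge0 ?exprn_ge0 ?normr_ge0 ?(ltW A0).
have := le_trans lb (le_trans _ (norm_dot_le (frame_op dot W w g) g)).
rewrite ger0_norm// => /(_ (lexx _)).
by rewrite expr2 mulrA ler_pM2r ?normr_gt0.
Qed.

(* If [frame_op] misses [h], then [frame_op_inv] returns [0] there, so its bound
   does not depend on the surjectivity of [frame_op]. *)
Lemma frame_op_inv_bound W w : fusion_frame dot W w ->
  exists2 A : K, 0 < A & forall h, `|frame_op_inv dot W w h| <= A * `|h|.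
Proof.
move=> /frame_op_lower_bound[A A0 hA]; exists A^-1; rewrite ?invr_gt0// => h.
rewrite /frame_op_inv; case: xgetP => [g _ /= gE|_]; last first.
  by rewrite normr0 mulr_ge0 ?invr_ge0 ?(ltW A0).
by rewrite ler_pdivlMl// -gE hA.
Qed.

(** * Bounds for [phi] composed with analysis *)

Lemma phi_analysis_bound V W w : (forall i, closed_subspace (V i)) ->
    fusion_frame dot W w ->
  exists2 A : K, 0 < A & forall h i,
    `|phi dot V W w (analysis dot W w h) i| ^+ 2 <=
      A * (w i ^+ 2 * `|orth_proj dot (W i) h| ^+ 2).
Proof.
move=> cV FW; have [A A0 hA] := frame_op_inv_bound FW.
exists (A ^+ 2) => [|h i]; first by rewrite exprn_gt0.
rewrite -norm_analysis_sqr; last by case: FW.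
rewrite -exprMn ler_pXn2r ?nnegrE// ?mulr_ge0 ?(ltW A0)//.
exact: le_trans (norm_orth_proj_le _ _) (hA _).
Qed.

(** The termwise bound is summed with the Bessel bound of [W]. The result gives membership in the l2
    sum and, later, the lower Riesz constant. *)
Lemma phi_analysis_partial_sum_bound V W w :
    (forall i, closed_subspace (V i)) -> fusion_frame dot W w ->
  exists2 M : K, 0 < M & forall h J,
    partial_sum (fun i => `|phi dot V W w (analysis dot W w h) i| ^+ 2) J <=
      M * `|h| ^+ 2.
Proof.
move=> cV FW; have [A A0 hA] := phi_analysis_bound cV FW.
have [B B0 hB] := fusion_frame_bessel FW.
exists (A * B) => [|h J]; first exact: mulr_gt0.
rewrite -mulrA; apply: (@le_trans _ _
    (A * partial_sum (fun i => w i ^+ 2 * `|orth_proj dot (W i) h| ^+ 2) J)).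
  by rewrite !partial_sumE mulr_sumr; apply: ler_sum.
by rewrite ler_pM2l//; exact: hB.
Qed.

Lemma phi_analysis_l2 V W w h : (forall i, closed_subspace (V i)) ->
    fusion_frame dot W w ->
  l2_sum V (phi dot V W w (analysis dot W w h)).
Proof.
move=> cV FW; split => [i|]; first exact: (orth_projP _ (cV i)).1.
have [M _ hM] := phi_analysis_partial_sum_bound cV FW.
apply: (bounded_unconditionally_cvg (M := M * `|h| ^+ 2)) => [i|J].
  by rewrite exprn_ge0.
exact: hM.
Qed.

(** * The cross Gram operator and fusion Riesz bases *)

Lemma cross_gram_idem V u W w f : dual_of dot V u W w ->
  cross_gram dot V u W w (cross_gram dot V u W w f) = cross_gram dot V u W w f.
Proof. by move=> VW; rewrite {1}/cross_gram (VW (synthesis u f)). Qed.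

(** For finite [J] containing [i], the lower Riesz bound puts [C * |f i - g i| ^+ 2] below the
    squared norm of the difference of the partial sums over [J], which tends to zero. *)
Lemma riesz_basis_synthesis_inj V u f g : fusion_frame dot V u ->
    fusion_riesz_basis V u ->
  l2_sum V f -> l2_sum V g -> synthesis u f = synthesis u g -> f = g.
Proof.
move=> FV [[cV _] _ [C [D [C0 _ CD]]]] Vf Vg fg; apply/funext => i.
have [[Vfi _] [Vgi _]] := (Vf, Vg).
suff : C * `|f i - g i| ^+ 2 <= 0.
  rewrite pmulr_rle0// real_exprn_even_le0 ?normr_real//= normr_eq0.
  by rewrite subr_eq0 => /eqP.
have Tf : partial_sum (fun i => u i *: f i) J @[J --> totally]
    --> synthesis u f.
  exact: synthesis_cvg Vf.
have Tg : partial_sum (fun i => u i *: g i) J @[J --> totally]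
    --> synthesis u g.
  exact: synthesis_cvg Vg.
pose d J := `|partial_sum (fun i => u i *: f i) J -
  partial_sum (fun i => u i *: g i) J| : K.
have d0 : d J @[J --> totally] --> (0 : K).
  rewrite -[0](@normr0 _ H) -(subrr (synthesis u g)) -{1}fg.
  by apply: cvg_norm; exact: cvgB.
have dd0 : d J * d J @[J --> totally] --> (0 * 0 : K) by exact: cvgM.
rewrite -[leRHS](mul0r 0).
apply: (le_cvg_scalar (cvg_cst (C * `|f i - g i| ^+ 2)) dd0).
apply: (@near_totally _ _ [fset i]%fset) => J iJ.
have [|lb _] := andP (CD J (fun i => f i - g i) _).
  by move=> j _; exact: closed_subspaceB.
apply: le_trans (_ : C * (\sum_(j <- J) `|f j - g j| ^+ 2) <= _).
  rewrite ler_pM2l// (big_fsetD1 i) ?(fsubsetP iJ) ?inE//=.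
  by rewrite lerDl sumr_ge0// => j _; rewrite exprn_ge0.
apply: le_trans lb _; rewrite -expr2 /d !partial_sumE.
rewrite [_ - _](_ : _ = \sum_(j <- J) u j *: (f j - g j))//=.
by rewrite -sumrB; apply: eq_bigr => j _; rewrite scalerBr.
Qed.

Lemma dual_closed_span V u W w : fusion_frame dot V u -> fusion_frame dot W w ->
  dual_of dot V u W w -> closed_span (\bigcup_i V i) = setT.
Proof.
move=> FV FW VW; apply/seteqP; split => // h _.
have cV : forall i, closed_subspace (V i) by case: FV => [[]].
have Vf := phi_analysis_l2 h cV FW; set f := phi _ _ _ _ _ in Vf.
have Th : partial_sum (fun i => u i *: f i) J @[J --> totally] --> h.
  by rewrite -[X in _ --> X](VW h); exact: synthesis_cvg Vf.
apply: (closed_cvg _ (@closed_closure H _) _ _ Th).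
(* Membership in the smallest subspace is tested on an arbitrary linear subspace [Y] containing
   every [V i]. *)
apply: nearW => J; apply: subset_closure => Y [[/set_mem Y0 YB] sub] /=.
have YD (a : K) x y : Y x -> Y y -> Y (a *: x + y).
  by move=> /mem_set Yx /mem_set Yy; apply/set_mem; exact: YB.
rewrite partial_sumE; elim/big_ind: _ => //.
- by move=> x y Yx Yy; rewrite -[x]scale1r; exact: YD.
- move=> i _; rewrite -[_ *: _]addr0; apply: (YD) => //; apply: sub.
  by exists i => //; case: Vf.
Qed.

Lemma cross_gram_id_riesz_basis V u W w :
    fusion_frame dot V u -> fusion_frame dot W w -> dual_of dot V u W w ->
  is_identity_on V (cross_gram dot V u W w) -> fusion_riesz_basis V u.
Proof.
move=> FV FW VW GI; have [[cV u0] _] := FV.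
split; [by [] | exact: dual_closed_span VW |].
have [M M0 hM] := phi_analysis_partial_sum_bound cV FW.
have [B B0 hB] := fusion_frame_bessel FV.
have M1 : 0 < M^-1 by rewrite invr_gt0.
(* The upper constant [B] would suffice for the estimate; adding [M^-1] makes [C <= D] immediate. *)
exists M^-1, (M^-1 + B); split => //; first by rewrite lerDl ltW.
move=> J f Vf; rewrite -!partial_sumE.
(* The family [f] is controlled only on [J]; its extension by zero lies in the l2 sum, where the
   Gram operator is the identity. *)
pose g i := if i \in J then f i else 0.
have gE (E : zmodType) (F : H -> E) :
    partial_sum (fun i => F (g i)) J = partial_sum (fun i => F (f i)) J.
  rewrite !partial_sumE big_seq [RHS]big_seq.
  by apply: eq_bigr => i iJ; rewrite /g iJ.
have g2 i : i \notin J -> (`|g i| ^+ 2 : K) = 0.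
  by move=> /negPf iJ; rewrite /g iJ normr0 expr0n.
have Vg : l2_sum V g.
  split=> [i|]; last first.
    apply/cvg_ex; exists (partial_sum (fun i => `|g i| ^+ 2 : K) J).
    exact: finite_support_cvg.
  rewrite /g; case: ifP => [/Vf//|_].
  by have [[/set_mem]] := cV i.
have Tg : synthesis u g = partial_sum (fun i => u i *: f i) J.
  rewrite (_ : partial_sum _ J = partial_sum (fun i => u i *: g i) J);
    last first.
    rewrite !partial_sumE big_seq [RHS]big_seq.
    by apply: eq_bigr => i iJ; rewrite /g iJ.
  apply: sum_unique; apply: finite_support_cvg => i /negPf iJ.
  by rewrite /g iJ scaler0.
apply/andP; split.
  (* The family bounded by [hM] at [synthesis u g] is the Gram image of [g], that is, [g] itself. *)
  rewrite ler_pdivrMl//; have := hM (synthesis u g) J.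
  rewrite -[phi _ _ _ _ _]/(cross_gram dot V u W w g) GI// Tg.
  by rewrite (gE _ (fun x => `|x| ^+ 2 : K)).
have fB := bessel_synthesis_bound FV.1 B0 hB Vf.
apply: le_trans fB _; rewrite mulrDl lerDr mulr_ge0 ?(ltW M1)//.
by rewrite sumr_ge0// => i _; rewrite exprn_ge0.
Qed.

End Families.
End HilbertSpace.

Theorem theorem3p9 (R : realType) (k : scalar_kind)
    (H : completeNormedModType (scalar_field R k))
    (dot : {dot H for conj_scalar R k}%R)
    (Hdot : norm_induced_by_dot dot) (Hsep : separable_space H)
    (I : countType)
    (W : I -> set H) (w : I -> scalar_field R k)
    (V : I -> set H) (u : I -> scalar_field R k)
    (W_frame : fusion_frame dot W w) (V_frame : fusion_frame dot V u)
    (V_dual : dual_of dot V u W w) :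
  (fusion_riesz_basis V u <-> is_identity_on V (cross_gram dot V u W w)) /\
  (is_identity_on V (cross_gram dot V u W w) <->
     has_left_inverse V (cross_gram dot V u W w)).
Proof.
have cV : forall i, closed_subspace (V i) by case: V_frame => [[]].
have GV f : l2_sum V (cross_gram dot V u W w f) by exact: phi_analysis_l2.
split; split.
- move=> VR f Vf.
  exact: (riesz_basis_synthesis_inj Hdot V_frame VR (GV f) Vf (V_dual _)).
- exact: cross_gram_id_riesz_basis.
- move=> GI; exists id => //; split=> //.
  exists 1; first exact: ler01.
  by move=> f _; rewrite expr1n mul1r.
- move=> [L _ LG] f Vf.
  (* Writing [G] for the Gram operator, [L (G (G f)) = G f] becomes [L (G f) = G f] by idempotence,
     while [L (G f) = f]. *)
  have := LG _ (GV f); rewrite /comp (cross_gram_idem f V_dual) => <-.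
  exact: LG f Vf.
Qed.
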